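(* Let $X$ and $Y$ be mm-spaces. Then \[ d_{\mathrm{Eur}}(X,Y)=\min_{\pi\in\Pi(m_X,m_Y)}\ \min_{\varepsilon\ge0}\max\{\varepsilon,\ (\pi\otimes\pi)(|d_X-d_Y|>\varepsilon)\}; \] in particular both minima are attained.
   Context: An mm-space is a complete separable metric space $(X,d_X)$ with a Borel probability measure $m_X$. $\Pi(m_X,m_Y)$: Borel probability measures on $X\times Y$ with marginals $m_X,m_Y$. $\pi\otimes\pi$ is the product measure on $X\times Y\times X\times Y$, and $\{|d_X-d_Y|>\varepsilon\}:=\{(x_1,y_1,x_2,y_2):|d_X(x_1,x_2)-d_Y(y_1,y_2)|>\varepsilon\}$. The Eurandom distance is $d_{\mathrm{Eur}}(X,Y):=\inf_{\pi\in\Pi(m_X,m_Y)}\inf_{\varepsilon\ge0}\max\{\varepsilon,(\pi\otimes\pi)(|d_X-d_Y|>\varepsilon)\}$. *)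

(* Defs.v *)
From HB Require Import structures.
From mathcomp Require Import all_boot all_order all_algebra.
From mathcomp Require Import all_classical all_reals all_analysis.
Set Implicit Arguments. Unset Strict Implicit. Unset Printing Implicit Defensive.
Import Order.TTheory GRing.Theory Num.Theory.
Local Open Scope classical_set_scope.
Local Open Scope ring_scope.

Section mm.
Context (R : realType) (d : measure_display) (T : measurableType d).

Definition is_metric (dist : T -> T -> R) : Prop :=
  [/\ forall x y, dist x y = 0 <-> x = y,
      forall x y, dist x y = dist y x &
      forall x y z, dist x z <= dist x y + dist y z].

Definition dopen (dist : T -> T -> R) (A : set T) : Prop :=
  forall x, A x -> exists r : R, 0 < r /\ forall y, dist x y < r -> A y.

Definition dcomplete (dist : T -> T -> R) : Prop :=
  forall u : nat -> T,
    (forall e : R, 0 < e -> exists N, forall m n, (N <= m)%N -> (N <= n)%N ->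
        dist (u m) (u n) < e) ->
    exists l, forall e : R, 0 < e -> exists N, forall n, (N <= n)%N -> dist (u n) l < e.

Definition dseparable (dist : T -> T -> R) : Prop :=
  exists D : set T, countable D /\
    forall x (e : R), 0 < e -> exists y, D y /\ dist x y < e.

(** (T, dist) is a complete separable metric space and the measurable sets
    of T are exactly its Borel sets (σ-algebra generated by the open sets).
    Together with a probability measure on T this is an mm-space. *)
Definition mm_space (dist : T -> T -> R) : Prop :=
  [/\ is_metric dist, dcomplete dist, dseparable dist &
      @measurable d T = <<s dopen dist >>].
End mm.

Section eurandom.
Context (R : realType) (d1 d2 : measure_display)
  (T1 : measurableType d1) (T2 : measurableType d2).
Variables (dX : T1 -> T1 -> R) (dY : T2 -> T2 -> R).

Definition coupling (mX : probability T1 R) (mY : probability T2 R)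
  (pi : probability (T1 * T2)%type R) : Prop :=
  (forall A, measurable A -> pi (fst @^-1` A) = mX A) /\
  (forall B, measurable B -> pi (snd @^-1` B) = mY B).

Definition dist_gap (eps : R) : set ((T1 * T2) * (T1 * T2))%type :=
  [set p | eps < `|dX p.1.1 p.2.1 - dY p.1.2 p.2.2|].

Definition eur_obj (pi : probability (T1 * T2)%type R) (eps : R) : \bar R :=
  maxe eps%:E ((pi \x pi)%E (dist_gap eps)).

Definition eur_inner (pi : probability (T1 * T2)%type R) : \bar R :=
  ereal_inf [set eur_obj pi e | e in [set e : R | 0 <= e]].

Definition d_Eur (mX : probability T1 R) (mY : probability T2 R) : \bar R :=
  ereal_inf [set eur_inner pi | pi in [set pi | coupling mX mY pi]].
End eurandom.

(* Main.v *)
Require Import Defs.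
From HB Require Import structures.
From mathcomp Require Import all_boot all_order all_algebra.
From mathcomp Require Import lra.
From mathcomp Require Import all_classical all_reals all_analysis.
Set Implicit Arguments. Unset Strict Implicit. Unset Printing Implicit Defensive.
Import Order.TTheory GRing.Theory Num.Theory.
Import numFieldNormedType.Exports.
Local Open Scope classical_set_scope.
Local Open Scope ring_scope.

(** For a fixed coupling the tail [eps |-> (pi \x pi)(gap > eps)] is
    right-continuous, so the infimum over [eps] is attained.

    For couplings, take a minimizing sequence [P_ n] and its setwise limit [lam]
    along a nonprincipal ultrafilter. [lam] is finitely additive with marginals
    [mX] and [mY]; since both are inner regular for compact sets, [lam] is
    countably subadditive on measurable rectangles (Marczewski), and Caratheodory
    extension gives a coupling [pi] agreeing with [lam] on rectangles. The set
    [gap > eps] is a countable union of products of four balls, and on finite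
    unions of those [P_ n \x P_ n] converges to [pi \x pi] by inclusion-exclusion;
    hence [(pi \x pi)(gap > eps)] is at most the limit of
    [(P_ n \x P_ n)(gap > eps)]. *)

(** * Monotone continuity of probability measures *)

Section probability_continuity.
Context (R : realType) (d : measure_display) (T : measurableType d).
Variable P : probability T R.

(** By contraposition: values that all stay at least [e] keep the limit at least [e]. *)
Lemma probability_lt_bigcap (F : nat -> set T) (e : \bar R) :
  (forall n, measurable (F n)) ->
  (forall m n, (m <= n)%N -> F n `<=` F m) ->
  (P (\bigcap_n F n) < e)%E -> exists n, (P (F n) < e)%E.
Proof.
move=> mF ndF; apply: contraPP => /forallNP Fe; apply/negP; rewrite -leNgt.
have cF : P (F n) @[n --> \oo] --> P (\bigcap_n F n).
  apply: nonincreasing_cvg_mu => //.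
  - by rewrite (le_lt_trans (probability_le1 P (mF 0%N))) ?ltry.
  - exact: bigcapT_measurable.
  - by move=> m n mn; apply/subsetPset; exact: ndF.
rewrite -(cvg_lim _ cF)//; apply: lime_ge; first exact: cvgP cF.
by near=> n; have /negP := Fe n; rewrite -leNgt.
Unshelve. all: by end_near. Qed.

Lemma probability_bigcup_le (F : nat -> set T) (e : \bar R) :
  (forall n, measurable (F n)) ->
  (forall m n, (m <= n)%N -> F m `<=` F n) ->
  (forall n, (P (F n) <= e)%E) -> (P (\bigcup_n F n) <= e)%E.
Proof.
move=> mF ndF Fe.
have cF : P (F n) @[n --> \oo] --> P (\bigcup_n F n).
  apply: nondecreasing_cvg_mu => //; first exact: bigcupT_measurable.
  by move=> m n mn; apply/subsetPset; exact: ndF.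
rewrite -(cvg_lim _ cF)//; apply: lime_le; first exact: cvgP cF.
by near=> n; exact: Fe.
Unshelve. all: by end_near. Qed.

End probability_continuity.

(** * Regularity and tightness on complete separable metric spaces *)

Section metric_measure.
Context (R : realType) (d : measure_display) (T : measurableType d).
Variables (dist : T -> T -> R) (P : probability T R).
Hypothesis hT : mm_space dist.

Let distC x y : dist x y = dist y x. Proof. by case: hT => -[]. Qed.
Let dist_triangle x y z : dist x z <= dist x y + dist y z.
Proof. by case: hT => -[]. Qed.
Let dist0 x : dist x x = 0.
Proof. by case: hT => -[h _ _] _ _ _; apply/h. Qed.

Lemma dopen_measurable A : dopen dist A -> measurable A.
Proof. by move=> oA; case: hT => _ _ _ ->; exact: sub_sigma_algebra. Qed.

Lemma dopen_setI A B : dopen dist A -> dopen dist B -> dopen dist (A `&` B).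
Proof.
move=> oA oB x [/oA [r [r0 rA]] /oB [s [s0 sB]]]; exists (Num.min r s).
split; first by rewrite lt_min r0.
by move=> y; rewrite lt_min => /andP[/rA ? /sB].
Qed.

Lemma dopen_bigcup (A : nat -> set T) : (forall n, dopen dist (A n)) ->
  dopen dist (\bigcup_n A n).
Proof.
move=> oA x [n _ /oA [r [r0 rA]]]; exists r; split=> // y /rA Ay.
by exists n.
Qed.

Lemma dopen_ball c r : dopen dist [set x | dist x c < r].
Proof.
move=> x /= xr; exists (r - dist x c); split; first by rewrite subr_gt0.
move=> y; rewrite ltrBrDl => h; apply: le_lt_trans h.
by rewrite addrC distC (distC x y) distC; exact: dist_triangle.
Qed.

Lemma dense_seq : exists u : nat -> T,
  forall x e, 0 < e -> exists n, dist x (u n) < e.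
Proof.
case: hT => _ _ [D [cD dD]] _.
have [y [Dy _]] := dD point 1 ltr01.
have [u su] : exists u : nat -> T, set_surj [set: nat] D u.
  by apply/pcard_surjP; exact: cD.
exists u => x e /(dD x)[z [/su [n _ <-] ?]]; by exists n.
Qed.

(** The sets with such approximations form a sigma-algebra containing the open sets, hence include
    every Borel set. *)
Lemma dopen_measurable_regular A (e : R) : measurable A -> 0 < e ->
  exists C U, [/\ dopen dist (~` C), dopen dist U, C `<=` A, A `<=` U &
    (P (U `\` C) < e%:E)%E].
Proof.
pose S := [set A | forall e : R, 0 < e -> exists C U,
  [/\ dopen dist (~` C), dopen dist U, C `<=` A, A `<=` U &
    (P (U `\` C) < e%:E)%E]].
suff mS : @measurable _ T `<=` S by move=> /mS; exact.
have dclosed_measurable C : dopen dist (~` C) -> measurable C.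
  by move=> /dopen_measurable /measurableC; rewrite setCK.
have dopenT : dopen dist setT by move=> x _; exists 1.
have dopen0 : dopen dist set0 by [].
have [_ _ _ ->] := hT; apply: smallest_sub; first split.
- by move=> r r0; exists set0, set0; split => //; rewrite ?setC0 ?setD0 ?measure0 ?lte_fin.
- move=> B SB r /SB[C [U [oC oU CB BU Pr]]]; exists (~` U), (~` C); split => //.
  + by rewrite setCK.
  + by rewrite setTD; exact: subsetC.
  + by rewrite setTD; exact: subsetC.
  + by rewrite setDE setCK setIC -setDE.
- move=> F SF r r0.
  have /choice[CU hCU] n : exists CU : set T * set T,
      [/\ dopen dist (~` CU.1), dopen dist CU.2, CU.1 `<=` F n, F n `<=` CU.2 &
        (P (CU.2 `\` CU.1) < (r / 2 / (2 ^ n.+1)%:R)%:E)%E].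
    have [|C [U h]] := SF n (r / 2 / (2 ^ n.+1)%:R).
      by rewrite !divr_gt0// ltr0n expn_gt0.
    by exists (C, U).
  pose C n := (CU n).1; pose U := \bigcup_n (CU n).2.
  have oC n : dopen dist (~` C n) by case: (hCU n).
  have oU : dopen dist U by apply: dopen_bigcup => n; case: (hCU n).
  (* A countable union of closed sets need not be closed, so finite unions [D N] are used: [U] minus
     [D N] shrinks to a set of measure at most [r / 2], and some [N] gives less than [r]. *)
  pose D N := \big[setU/set0]_(i < N) C i.
  have oD N : dopen dist (~` D N).
    rewrite /D; elim: N => [|N IH]; first by rewrite big_ord0 setC0.
    by rewrite big_ord_recr /= setCU; exact: dopen_setI.
  have [|||N PN] := @probability_lt_bigcap _ _ _ P (fun N => U `\` D N) r%:E.
  + move=> N; apply: measurableD; first exact: dopen_measurable.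
    exact: dclosed_measurable.
  + by move=> m n mn; apply: setDS; apply: subset_bigsetU.
  + apply: (@le_lt_trans _ _ (r / 2)%:E); last first.
      by rewrite lte_fin ltr_pdivrMr// mulr2n mulrDr mulr1 ltrDl.
    apply: (@le_trans _ _ (\sum_(0 <= n <oo) P ((CU n).2 `\` (CU n).1))%E); last first.
      apply: le_trans (@epsilon_trick0 _ (r / 2) xpredT _); last by rewrite ltW ?divr_gt0.
      by apply: lee_nneseries => // n _; have [_ _ _ _ /ltW] := hCU n.
    apply: measure_sigma_subadditive => [n||x].
    * apply: measurableD; last exact: dclosed_measurable (oC n).
      by apply: dopen_measurable; case: (hCU n).
    * apply: bigcapT_measurable => n; apply: measurableD; first exact: dopen_measurable.
      exact: dclosed_measurable.
    * move=> xUD; have [[n _ Ux] _] := xUD 0%N I.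
      exists n => //; split=> // Cx; have [_] := xUD n.+1 I; apply.
      by rewrite /D big_ord_recr; right.
  exists (D N), U; split => //.
  + move=> x; rewrite /D -bigcup_mkord => -[n _ Cx]; exists n => //.
    by case: (hCU n) => _ _ CF _ _; exact: CF.
  + by move=> x [n _ Fx]; exists n => //; case: (hCU n) => _ _ _ FU _; exact: FU.
- move=> B oB r r0.
  (* The points whose ball of radius 1/(n+1) stays in [B]: closed sets that increase to [B] because
     [B] is open. *)
  pose C n := [set x | forall y, dist x y < n.+1%:R^-1 -> B y].
  have oC n : dopen dist (~` C n).
    move=> x /existsNP[y /not_implyP[xy By]].
    exists (n.+1%:R^-1 - dist x y); split; first by rewrite subr_gt0.
    move=> z xz /(_ y) Cz; apply: By; apply: Cz; apply: le_lt_trans (dist_triangle _ x _) _.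
    by rewrite distC -ltrBrDr.
  have CB n : C n `<=` B by move=> x; apply; rewrite dist0 invr_gt0.
  have [|||N PN] := @probability_lt_bigcap _ _ _ P (fun N => B `\` C N) r%:E.
  + move=> N; apply: measurableD; first exact: dopen_measurable.
    exact: dclosed_measurable.
  + move=> m n mn; apply: setDS => x Cx y xy; apply: Cx; apply: lt_le_trans xy _.
    by rewrite lef_pV2 ?posrE// ler_nat.
  + rewrite (_ : \bigcap_n _ = set0) ?measure0 ?lte_fin//; apply/seteqP; split=> // x BCx.
    have [/oB[s [s0 sB]] _] := BCx 0%N I.
    have [n ns] : exists n, n.+1%:R^-1 < s.
      have [n _ /(_ n (leqnn _)) ?] := near_infty_natSinv_lt (PosNum s0).
      by exists n.
    have [_] := BCx n I; apply => y xy; apply: sB; exact: lt_trans xy ns.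
  by exists (C N), B; split.
Qed.

(* Total boundedness gives ultrafilter-Cauchy, completeness the limit, and
   closedness of the inner approximant keeps the limit inside [A]. *)
Lemma inner_ultracompact A (e : R) : measurable A -> 0 < e ->
  exists K, [/\ measurable K, K `<=` A, (P (A `\` K) <= e%:E)%E &
    forall (F : set_system nat) (x : nat -> T), UltraFilter F ->
      (forall n, K (x n)) ->
      exists2 l, A l & forall r, 0 < r -> F [set n | dist (x n) l < r]].
Proof.
move=> mA e0; have e20 : 0 < e / 2 by rewrite divr_gt0.
have [C [U [oC oU CA AU PUC]]] := dopen_measurable_regular mA e20.
have mC : measurable C by move/dopen_measurable/measurableC : oC; rewrite setCK.
have [u hu] := dense_seq.
(* For fixed [k] these finite unions of balls exhaust the space by density. Half of [e] pays for the
   closed set [C]; the other half is split geometrically over [k]. *)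
pose B k N := \big[setU/set0]_(i < N) [set x | dist x (u i) < k.+1%:R^-1].
have mB k N : measurable (B k N).
  by apply: bigsetU_measurable => i _; apply: dopen_measurable; exact: dopen_ball.
have /choice[N hN] k : exists N, (P (~` B k N) < (e / 2 / (2 ^ k.+1)%:R)%:E)%E.
  apply: probability_lt_bigcap.
  - by move=> n; exact: measurableC.
  - by move=> m n mn; apply: subsetC; exact: (@subset_bigsetU _ (fun i => [set x | dist x (u i) < k.+1%:R^-1])).
  - rewrite (_ : \bigcap_n _ = set0).
      by rewrite measure0 lte_fin !divr_gt0// ltr0n expn_gt0.
    apply/seteqP; split=> // x Bx.
    have [|n xn] := hu x k.+1%:R^-1; first by rewrite invr_gt0.
    by apply: (Bx n.+1 I); rewrite /B big_ord_recr; right.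
pose K := C `&` \bigcap_k B k (N k).
have mK : measurable K.
  by apply: measurableI => //; apply: bigcapT_measurable => k; exact: mB.
exists K; split => //; first by move=> x [/CA].
- have -> : e%:E = ((e / 2)%:E + (e / 2)%:E)%E by rewrite -EFinD -splitr.
  apply: (@le_trans _ _ (P ((U `\` C) `|` \bigcup_k ~` B k (N k)))).
    apply: le_measure; rewrite ?inE.
    + exact: measurableD.
    + apply: measurableU.
        by apply: measurableD => //; exact: dopen_measurable.
      by apply: bigcupT_measurable => k; exact: measurableC.
    + move=> x [Ax /not_andP[Cx|Bx]]; first by left; split => //; exact: AU.
      by right; rewrite -setC_bigcap.
  apply: le_trans (measureU2 _ _ _) _.
  + by apply: measurableD => //; exact: dopen_measurable.
  + by apply: bigcupT_measurable => k; exact: measurableC.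
  + apply: leeD; first exact: ltW.
    apply: (@le_trans _ _ (\sum_(0 <= k <oo) P (~` B k (N k)))%E); last first.
      apply: le_trans (@epsilon_trick0 _ (e / 2) xpredT _); last exact: ltW.
      by apply: lee_nneseries => // n _; have /ltW := hN n.
    apply: measure_sigma_subadditive => //.
      by move=> k; exact: measurableC.
    by apply: bigcupT_measurable => k; exact: measurableC.
- move=> F x uF Kx.
  (* Finitely many balls of radius 1/(k+1) cover [K], so the ultrafilter selects one of them; [c k]
     is its centre. *)
  have /choice[c hc] k : exists c0, F [set n | dist (x n) c0 < k.+1%:R^-1].
    have : F [set n | B k (N k) (x n)].
      by apply: filterS filterT => n _; have [_] := Kx n; exact.
    rewrite /B; elim: (N k) => [|M IH].
      by rewrite big_ord0 => /filter_ex[].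
    rewrite big_ord_recr/= => h.
    have [?|h'] := in_ultra_setVsetC [set n | dist (x n) (u M) < k.+1%:R^-1] uF.
      by exists (u M).
    apply: IH; apply: filterS (filterI h h') => n /= [[//|xn]]; by move=> /(_ xn).
  have [l hl] : exists l, forall r, 0 < r ->
      exists n0, forall n, (n0 <= n)%N -> dist (c n) l < r.
    case: hT => _ + _ _; apply => r r0.
    have [n0 _ hn0] := near_infty_natSinv_lt (PosNum (divr_gt0 r0 (ltr0n _ 2))).
    exists n0 => m n mn0 nn0.
    (* Two sets of the ultrafilter meet, so some [x p] lies near both centres; hence [c] is
       Cauchy. *)
    have [p /= [pm pn]] := filter_ex (filterI (hc m) (hc n)).
    apply: le_lt_trans (dist_triangle _ (x p) _) _.
    rewrite (splitr r) distC ltrD//.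
      by apply: lt_trans pm _; exact: hn0.
    by apply: lt_trans pn _; exact: hn0.
  have Fl r : 0 < r -> F [set n | dist (x n) l < r].
    move=> r0; have r20 : 0 < r / 2 by rewrite divr_gt0.
    have [n0 hn0] := hl _ r20.
    have [n1 _ hn1] := near_infty_natSinv_lt (PosNum r20).
    apply: filterS (hc (maxn n0 n1)) => p /= pc.
    apply: le_lt_trans (dist_triangle _ (c (maxn n0 n1)) _) _.
    rewrite (splitr r) ltrD//; last by apply: hn0; exact: leq_maxl.
    by apply: lt_trans pc _; apply: hn1; exact: leq_maxr.
  exists l => //; apply: CA; apply: contrapT => /oC[r [r0 hr]].
  have [p /= pl] := filter_ex (Fl r r0).
  by have [+ _] := Kx p; apply: hr; rewrite distC.
Qed.

End metric_measure.

(** * The semiring of measurable rectangles *)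

(** A display only labels a measurable structure. [Qed] makes this one opaque, which gives the
    rectangles a label of their own, distinct from that of the product. *)
Definition rect_display (d1 d2 : measure_display) : measure_display.
Proof. exact: d1. Qed.

(* An alias of the product: its measurable sets are the measurable rectangles
   only, so that Caratheodory extension applies to this semiring. *)
Definition rectType (T1 T2 : Type) : Type := (T1 * T2)%type.

Section rectangles.
Context (d1 d2 : measure_display).
Context (T1 : measurableType d1) (T2 : measurableType d2).

Definition rectangle : set (set (rectType T1 T2)) :=
  [set A `*` B | A in measurable & B in measurable].

Let rectangle0 : rectangle set0.
Proof. by exists set0 => //; exists set0 => //; rewrite set0X. Qed.

Let rectangleI : setI_closed rectangle.
Proof.
move=> _ _ [A mA [B mB <-]] [A' mA' [B' mB' <-]].
exists (A `&` A'); first exact: measurableI.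
exists (B `&` B'); first exact: measurableI.
by apply/seteqP; split=> -[x y] /=; tauto.
Qed.

Let rectangleD : semi_setD_closed rectangle.
Proof.
move=> _ _ [A mA [B mB <-]] [A' mA' [B' mB' <-]].
exists ([set (A `\` A') `*` B] `|` [set (A `&` A') `*` (B `\` B')]); split.
- by rewrite finite_setU; split; exact: finite_set1.
- move=> _ [->|->].
    by exists (A `\` A'); [exact: measurableD | exists B].
  exists (A `&` A'); first exact: measurableI.
  by exists (B `\` B') => //; exact: measurableD.
- rewrite bigcup_setU !bigcup_set1; apply/seteqP; split=> -[x y] /=; last by tauto.
  by move=> -[[Ax By]] /not_andP[|]; have [] := pselect (A' x); tauto.
- move=> _ _ [->|->] [->|->] //= -[[x y]] /=; tauto.
Qed.

HB.instance Definition _ := Pointed.copy (rectType T1 T2) (T1 * T2)%type.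
HB.instance Definition _ := isSemiRingOfSets.Build (rect_display d1 d2)
  (rectType T1 T2) rectangle0 rectangleI rectangleD.

Lemma rectangle_measurable (A : set (rectType T1 T2)) :
  measurable A -> measurable (A : set (T1 * T2)).
Proof. by move=> [B mB [C mC <-]]; exact: measurableX. Qed.

End rectangles.

(** * Caratheodory extension from rectangles to the product sigma-algebra *)

Section content_extension.
Context (R : realType) (d1 d2 : measure_display).
Context (T1 : measurableType d1) (T2 : measurableType d2).
Variable lam : {content set (T1 * T2)%type -> \bar R}.

Definition rect_content (A : set (rectType T1 T2)) : \bar R := lam A.

Let rect_content_ge0 A : (0 <= rect_content A)%E.
Proof. exact: measure_ge0. Qed.

Let rect_content_semi_additive : measure_function.semi_additive rect_content.
Proof.
move=> F n mF tF mU; apply: measure_semi_additive => //.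
  by move=> k; exact: rectangle_measurable.
exact: rectangle_measurable.
Qed.

HB.instance Definition _ := isContent.Build _ _ _ rect_content
  rect_content_ge0 rect_content_semi_additive.

(** A countably subadditive content on the semiring is a premeasure. Its outer measure is countably
    additive on the Caratheodory sets, and these contain the product sigma-algebra, which rectangles
    generate. *)
Lemma rect_content_extend :
  measurable_subset_sigma_subadditive rect_content ->
  lam setT = 1%E ->
  exists pi : probability (T1 * T2)%type R, forall A B,
    measurable A -> measurable B -> pi (A `*` B) = lam (A `*` B).
Proof.
move=> subl lam1.
pose mu : {measure set (rectType T1 T2) -> \bar R} := HB.pack rect_content
  (Content_SigmaSubAdditive_isMeasure.Build _ _ _ rect_content subl).
pose f : set (T1 * T2) -> \bar R := mu^*%mu.
have fE A B : measurable A -> measurable B -> f (A `*` B) = lam (A `*` B).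
  by move=> mA mB; rewrite /f measurable_mu_extE//; exists A => //; exists B.
have f0 : f set0 = 0%E by exact: mu_ext0.
have f_ge0 A : (0 <= f A)%E by exact: mu_ext_ge0.
have fs : semi_sigma_additive f.
  have cara (A : set (T1 * T2)) : measurable A -> mu^*%mu.-cara.-measurable A.
    by rewrite measurable_prod_measurableType => mA; exact: sub_caratheodory.
  move=> F mF tF mU; apply: caratheodory_measure_sigma_additive => //.
    by move=> i; exact: cara.
  exact: cara.
pose M : {measure set (T1 * T2)%type -> \bar R} := HB.pack f
  (isMeasure.Build _ _ _ f f0 f_ge0 fs).
have M1 : M setT = 1%E by rewrite -setXTT /= fE// setXTT.
pose P : probability (T1 * T2)%type R := HB.pack (f : set (T1 * T2) -> \bar R) M
  (Measure_isProbability.Build _ _ _ M M1).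
by exists P.
Qed.

End content_extension.

(** * Finitely additive couplings and Marczewski's compactness argument *)

Section content_coupling.
Context (R : realType) (d1 d2 : measure_display).
Context (T1 : measurableType d1) (T2 : measurableType d2).
Variables (dX : T1 -> T1 -> R) (dY : T2 -> T2 -> R).
Hypotheses (hX : mm_space dX) (hY : mm_space dY).
Variables (mX : probability T1 R) (mY : probability T2 R).
Variable lam : {content set (T1 * T2)%type -> \bar R}.
Hypothesis lamX : forall A, measurable A -> lam (fst @^-1` A) = mX A.
Hypothesis lamY : forall B, measurable B -> lam (snd @^-1` B) = mY B.

Let measurable_fstP A : measurable A -> measurable (fst @^-1` A : set (T1 * T2)).
Proof. by move=> mA; rewrite -[X in measurable X]setTI; exact: measurable_fst. Qed.
Let measurable_sndP B : measurable B -> measurable (snd @^-1` B : set (T1 * T2)).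
Proof. by move=> mB; rewrite -[X in measurable X]setTI; exact: measurable_snd. Qed.

(** Marginals control cylinders, so trading one rectangle for another costs only the marginal
    measure of the discrepancy in each coordinate. *)
Let lam_le3 E E0 A B (a b : \bar R) : measurable E -> measurable E0 ->
  measurable A -> measurable B -> (mX A <= a)%E -> (mY B <= b)%E ->
  E `<=` E0 `|` fst @^-1` A `|` snd @^-1` B -> (lam E <= lam E0 + (a + b))%E.
Proof.
move=> mE mE0 mA mB Aa Bb EE0.
have m1 := measurable_fstP mA; have m2 := measurable_sndP mB.
have mU := measurableU _ _ mE0 m1.
apply: le_trans (le_measure lam _ _ EE0) _; rewrite ?inE//.
  exact: measurableU.
apply: le_trans (measureU2 lam mU m2) _.
apply: (@le_trans _ _ ((lam E0 + lam (fst @^-1` A)) + lam (snd @^-1` B))%E).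
  by apply: leeD => //; exact: measureU2.
by rewrite -addeA leeD2l// leeD// ?lamX// lamY.
Qed.

(* A countable cover of the ultracompact rectangle [K `*` L] by open rectangles
   has a finite subcover: otherwise choose uncovered points [x n] for all
   [n]; their limit along a nonprincipal ultrafilter is covered. *)
Lemma coupling_content_sigma_subadditive :
  measurable_subset_sigma_subadditive (rect_content lam).
Proof.
move=> _ F mF [A mA [B mB <-]] AF.
have /choice[G hG] n : exists G : set T1 * set T2,
    [/\ measurable G.1, measurable G.2 & F n = G.1 `*` G.2].
  by have [A' mA' [B' mB' <-]] := mF n; exists (A', B').
apply/lee_addgt0Pr => e' e'0; set e := e' / 2 / 2.
have e0 : 0 < e by rewrite !divr_gt0.
have en0 n : 0 < e / (2 ^ n.+1)%:R by rewrite divr_gt0// ltr0n expn_gt0.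
have [K [mK KA PK limK]] := inner_ultracompact mX hX mA e0.
have [L [mL LB PL limL]] := inner_ultracompact mY hY mB e0.
have /choice[U hU] n : exists U, [/\ dopen dX U, (G n).1 `<=` U &
    (mX (U `\` (G n).1) <= (e / (2 ^ n.+1)%:R)%:E)%E].
  have [mG _ _] := hG n.
  have [C [U [oC oU CG GU PU]]] := dopen_measurable_regular mX hX mG (en0 n).
  exists U; split => //; apply: le_trans (ltW PU); apply: le_measure.
  - by rewrite inE; apply: measurableD => //; exact: (dopen_measurable hX).
  - rewrite inE; apply: measurableD; first exact: (dopen_measurable hX).
    by move/(dopen_measurable hX)/measurableC : oC; rewrite setCK.
  - exact: setDS.
have /choice[V hV] n : exists V, [/\ dopen dY V, (G n).2 `<=` V &
    (mY (V `\` (G n).2) <= (e / (2 ^ n.+1)%:R)%:E)%E].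
  have [_ mG _] := hG n.
  have [C [U' [oC oU CG GU PU]]] := dopen_measurable_regular mY hY mG (en0 n).
  exists U'; split => //; apply: le_trans (ltW PU); apply: le_measure.
  - by rewrite inE; apply: measurableD => //; exact: (dopen_measurable hY).
  - rewrite inE; apply: measurableD; first exact: (dopen_measurable hY).
    by move/(dopen_measurable hY)/measurableC : oC; rewrite setCK.
  - exact: setDS.
have mUV n : measurable (U n `*` V n).
  apply: measurableX.
    by apply: (dopen_measurable hX); case: (hU n).
  by apply: (dopen_measurable hY); case: (hV n).
have [N KLN] : exists N, K `*` L `<=` \big[setU/set0]_(i < N) (U i `*` V i).
  apply: contrapT => /forallNP H.
  have /choice[p hp] n : exists p, (K `*` L) p /\
      forall i, (i < n)%N -> ~ (U i `*` V i) p.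
    have /existsNP[p /not_implyP[KLp pN]] := H n.
    exists p; split=> // i im UVp; apply: pN.
    by rewrite -(bigcup_mkord n (fun i => U i `*` V i)); exists i.
  have [W [uW oW]] := ultraFilterLemma eventually_filter.
  have [x Ax hx] := limK W (fst \o p) uW (fun n => (hp n).1.1).
  have [y By hy] := limL W (snd \o p) uW (fun n => (hp n).1.2).
  have [i _] : (\bigcup_n F n) (x, y) by apply: AF.
  have [_ _ ->] := hG i => -[/= Gx Gy].
  have [oU GU _] := hU i; have [oV GV _] := hV i.
  have [r [r0 rU]] := oU x (GU _ Gx); have [s [s0 sV]] := oV y (GV _ Gy).
  have pW : ProperFilter W by exact: ultra_proper.
  (* At an index [n] beyond [i] with [p n] near the limit, [p n] lies in the [i]-th open rectangle,
     though it was chosen outside the first [n] of them. *)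
  have [n /= [[xn yn] ni]] :=
    filter_ex (filterI (filterI (hx r r0) (hy s s0)) (oW _ (nbhs_infty_gt i))).
  apply: (hp n).2 ni _; split.
    by apply: rU; case: hX => -[_ -> _].
  by apply: sV; case: hY => -[_ -> _].
apply: (@le_trans _ _ (\sum_(0 <= n <oo)
    (rect_content lam (F n) + (2 * e / (2 ^ n.+1)%:R)%:E) + (2 * e)%:E)%E); last first.
  have -> : e'%:E = ((2 * e)%:E + (2 * e)%:E)%E.
    by rewrite -EFinD; congr EFin; rewrite /e; lra.
  rewrite addeA leeD2r//; apply: epsilon_trick => //.
  by rewrite mulr_ge0// ltW.
apply: (@le_trans _ _ (lam (K `*` L) + (2 * e)%:E)%E).
  have -> : (2 * e)%:E = (e%:E + e%:E)%E by rewrite -EFinD mulr_natl mulr2n.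
  apply: (@lam_le3 _ _ (A `\` K) (B `\` L)) => //.
  - exact: measurableX.
  - exact: measurableX.
  - exact: measurableD.
  - exact: measurableD.
  - move=> [x y] [/= Ax By]; have [Kx|] := pselect (K x); last by left; right.
    by have [Ly|] := pselect (L y); [left; left|right].
rewrite leeD2r//.
apply: (@le_trans _ _ (\sum_(n < N) lam (U n `*` V n))%E).
  apply: (@content_subadditive _ _ _ lam _ (fun n => U n `*` V n)) => //.
  exact: measurableX.
apply: (@le_trans _ _ (\sum_(n < N)
    (rect_content lam (F n) + (2 * e / (2 ^ n.+1)%:R)%:E))%E).
  apply: lee_sum => n _; have [mG1 mG2 FG] := hG n.
  have [oU GU PU] := hU n; have [oV GV PV] := hV n.
  have -> : (2 * e / (2 ^ n.+1)%:R)%:E =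
    ((e / (2 ^ n.+1)%:R)%:E + (e / (2 ^ n.+1)%:R)%:E)%E.
    by rewrite -EFinD -mulrA mulr_natl mulr2n.
  apply: (@lam_le3 _ _ (U n `\` (G n).1) (V n `\` (G n).2)) => //.
  - exact: rectangle_measurable.
  - by apply: measurableD => //; exact: (dopen_measurable hX).
  - by apply: measurableD => //; exact: (dopen_measurable hY).
  - rewrite FG => -[x y] [/= Ux Vy].
    have [?|?] := pselect ((G n).1 x); last by left; right.
    by have [?|?] := pselect ((G n).2 y); [left; left|right].
rewrite -(big_mkord xpredT (fun n => rect_content lam (F n) + (2 * e / (2 ^ n.+1)%:R)%:E)%E).
by apply: nneseries_lim_ge => n _ _; rewrite adde_ge0// lee_fin divr_ge0// mulr_ge0// ltW.
Qed.

Lemma coupling_of_content : exists pi : probability (T1 * T2)%type R,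
  coupling mX mY pi /\ forall A B, measurable A -> measurable B ->
    pi (A `*` B) = lam (A `*` B).
Proof.
have lam1 : lam setT = 1%E.
  by rewrite -(preimage_setT fst) lamX// probability_setT.
have [pi piE] := rect_content_extend coupling_content_sigma_subadditive lam1.
exists pi; split => //; split=> A mA.
  by rewrite -setXT piE// setXT lamX.
by rewrite -setTX piE// setTX lamY.
Qed.

End content_coupling.

(** * Limits along an ultrafilter *)

Section ultralimit.
Context (R : realType) (d : measure_display) (T : measurableType d).
Context (W : set_system nat) (uW : UltraFilter W).
Variable P_ : nat -> probability T R.

Let pW : ProperFilter W. Proof. exact: ultra_proper. Qed.

Let fineP01 A n : measurable A -> 0 <= fine (P_ n A) <= 1.
Proof.
move=> mA; rewrite fine_ge0 ?measure_ge0//= -lee_fin fineK ?fin_num_measure//.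
exact: probability_le1.
Qed.

(** For an ultrafilter a cluster point is a limit: if the preimage of a neighbourhood were not in
    [W], that of its complement would be, and the complement would have to meet the
    neighbourhood. *)
Lemma ultra_cvg_compact (X : topologicalType) (K : set X) (x : nat -> X) :
  compact K -> (forall n, K (x n)) -> exists2 l, K l & x n @[n --> W] --> l.
Proof.
move=> cK Kx; have [|l [Kl cl]] := cK (x @ W) _; first exact: nearW.
exists l => // B lB; have [//|nB] := in_ultra_setVsetC (x @^-1` B) uW.
by have [y []] := cl (~` B) B nB lB.
Qed.

(** Probabilities lie in the compact unit interval, so every measurable set has a limit value.
    Finite sums commute with limits, which gives additivity; countable additivity may be lost. *)
Lemma ultralimit_content : exists lam : {content set T -> \bar R},
  forall A, measurable A ->
    lam A \is a fin_num /\ fine (P_ n A) @[n --> W] --> fine (lam A).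
Proof.
have /choice[l hl] (A : set T) : exists l : R, 0 <= l /\
    (measurable A -> fine (P_ n A) @[n --> W] --> l).
  (* Non-measurable sets get the default value 0. *)
  have [mA|nmA] := pselect (measurable A); last by exists 0.
  have [||l] := @ultra_cvg_compact R `[0, 1] (fun n => fine (P_ n A)).
  - exact: segment_compact.
  - by move=> n; rewrite /= in_itv/=; exact: fineP01.
  - by rewrite /= in_itv/= => /andP[l0 _] cl; exists l.
pose f A := (l A)%:E.
have f0 A : (0 <= f A)%E by rewrite lee_fin; case: (hl A).
have fadd : measure_function.semi_additive f.
  move=> F n mF tF mU; rewrite /f sumEFin; congr EFin.
  rewrite -(cvg_lim (@Rhausdorff R) ((hl _).2 mU)); apply: (cvg_lim (@Rhausdorff R)).
  have -> : (fun k => fine (P_ k (\big[setU/set0]_(i < n) F i))) =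
      (fun k => \sum_(i < n) fine (P_ k (F i))).
    apply/funext => k; rewrite measure_semi_additive// sum_fine// => i _.
    exact: fin_num_measure.
  elim: n {mU} => [|n IH].
    by under eq_fun do rewrite big_ord0; rewrite big_ord0; exact: cvg_cst.
  under eq_fun do rewrite big_ord_recr/=; rewrite big_ord_recr/=.
  by apply: cvgD => //; exact: (hl _).2.
pose lam : {content set T -> \bar R} :=
  HB.pack f (isContent.Build _ _ _ f f0 fadd).
by exists lam => A mA; split=> //=; exact: (hl A).2.
Qed.

Variables (P : probability T R) (G : set (set T)).
Hypothesis GI : setI_closed G.
Hypothesis GM : G `<=` measurable.
Hypothesis GP : forall A, G A -> fine (P_ n A) @[n --> W] --> fine (P A).

(** Inclusion-exclusion for one added set: its intersection with the earlier union is a union of [N]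
    members of [G], so induction over all sequences [F] applies. *)
Lemma cvg_probability_bigsetU (F : nat -> set T) N : (forall i, G (F i)) ->
  fine (P_ n (\big[setU/set0]_(i < N) F i)) @[n --> W] -->
  fine (P (\big[setU/set0]_(i < N) F i)).
Proof.
elim: N F => [|N IH] F GF.
  rewrite big_ord0 measure0.
  by under eq_fun do rewrite measure0; exact: cvg_cst.
have mF i : measurable (F i) by exact: GM.
have mU : measurable (\big[setU/set0]_(i < N) F i) by exact: bigsetU_measurable.
have QE (Q : probability T R) : fine (Q (\big[setU/set0]_(i < N.+1) F i)) =
    fine (Q (\big[setU/set0]_(i < N) F i)) + fine (Q (F N)) -
    fine (Q (\big[setU/set0]_(i < N) (F i `&` F N))).
  have mUI : measurable (\big[setU/set0]_(i < N) (F i `&` F N)).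
    by apply: bigsetU_measurable => i _; exact: measurableI.
  rewrite big_ord_recr/= measureUfinl//; last first.
    by rewrite (le_lt_trans (probability_le1 Q mU)) ?ltry.
  rewrite (_ : (_ `&` F N) = \big[setU/set0]_(i < N) (F i `&` F N)); last first.
    by rewrite big_distrl.
  by rewrite fineB ?fineD ?fin_numD ?fin_num_measure.
under eq_fun do rewrite QE.
rewrite QE; apply: cvgB; last by apply: (IH (fun i => F i `&` F N)) => i; exact: GI.
by apply: cvgD; [exact: IH | exact: GP].
Qed.

End ultralimit.

(** * The gap sets and the objective *)

Section gap.
Context (R : realType) (d1 d2 : measure_display).
Context (T1 : measurableType d1) (T2 : measurableType d2).
Variables (dX : T1 -> T1 -> R) (dY : T2 -> T2 -> R).
Hypotheses (hX : mm_space dX) (hY : mm_space dY).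
Local Notation T := (T1 * T2)%type.

(** A family closed under intersection on which a product measure factors into the masses of two
    rectangles, so convergence on rectangles passes to boxes. *)
Definition box : set (set (T * T)) :=
  [set S | exists A1 B1 A2 B2, [/\ measurable A1, measurable B1,
    measurable A2, measurable B2 &
    S = (A1 `*` B1) `*` (A2 `*` B2)]].

Lemma box_setI : setI_closed box.
Proof.
move=> _ _ [A1 [B1 [A2 [B2 [mA1 mB1 mA2 mB2 ->]]]]]
  [A1' [B1' [A2' [B2' [mA1' mB1' mA2' mB2' ->]]]]].
exists (A1 `&` A1'), (B1 `&` B1'), (A2 `&` A2'), (B2 `&` B2').
split; try exact: measurableI.
by apply/seteqP; split=> -[[x1 y1] [x2 y2]] /=; tauto.
Qed.

Lemma box_measurable : box `<=` measurable.
Proof.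
move=> _ [A1 [B1 [A2 [B2 [mA1 mB1 mA2 mB2 ->]]]]].
by apply: measurableX; exact: measurableX.
Qed.

Lemma box_set0 : box set0.
Proof. by exists set0, set0, set0, set0; split => //; rewrite !setX0. Qed.

(** Points within [r] of a common centre are less than [2 * r] apart, and a distance is 1-Lipschitz
    in each argument. *)
Lemma dist_le_near (d : measure_display) (S : measurableType d)
    (dist : S -> S -> R) (h : mm_space dist) x1 x2 z1 z2 a1 a2 r :
  dist x1 a1 < r -> dist x2 a2 < r -> dist z1 a1 < r -> dist z2 a2 < r ->
  `|dist x1 x2 - dist z1 z2| < 4 * r.
Proof.
case: h => -[_ C Tr] _ _ _ h1 h2 h3 h4.
have near x z a : dist x a < r -> dist z a < r -> dist x z < 2 * r.
  move=> xa za; apply: le_lt_trans (Tr x a z) _.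
  by rewrite mulr_natl mulr2n (C a z) ltrD.
have D x y z w : dist x y - dist z w <= dist x z + dist y w.
  have := Tr x z y; have := Tr z w y; rewrite (C w y).
  move: (dist x z) (dist z y) (dist x y) (dist z w) (dist y w).
  by move=> p q s t w'; lra.
have := near _ _ _ h1 h3; have := near _ _ _ h2 h4.
have := D x1 x2 z1 z2; have := D z1 z2 x1 x2; rewrite (C z1 x1) (C z2 x2).
move: (dist x1 x2) (dist z1 z2) (dist x1 z1) (dist x2 z2) => p q s t.
by clear => *; rewrite ltr_norml; apply/andP; split; lra.
Qed.

(** The gap set is open, so it is the union of the boxes of balls inside it with centres in dense
    sequences and radii 1/(k+1). *)
Lemma dist_gap_bigcup_box (e : R) :
  exists H : nat -> set (T * T), (forall n, box (H n)) /\
    dist_gap dX dY e = \bigcup_n H n.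
Proof.
have [u hu] := dense_seq hX; have [v hv] := dense_seq hY.
pose J := (nat * nat * nat * nat * nat)%type.
pose Q (i : J) : set (T * T) := let: (a1, b1, a2, b2, k) := i in
  ([set x | dX x (u a1) < k.+1%:R^-1] `*` [set y | dY y (v b1) < k.+1%:R^-1]) `*`
  ([set x | dX x (u a2) < k.+1%:R^-1] `*` [set y | dY y (v b2) < k.+1%:R^-1]).
have bQ i : box (Q i).
  move: i => [[[[a1 b1] a2] b2] k].
  do 4 eexists; split; last by reflexivity.
  - by apply: (dopen_measurable hX); exact: dopen_ball.
  - by apply: (dopen_measurable hY); exact: dopen_ball.
  - by apply: (dopen_measurable hX); exact: dopen_ball.
  - by apply: (dopen_measurable hY); exact: dopen_ball.
(* Numbers that code no tuple, or whose box leaves the gap set, contribute the empty set. *)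
pose H n := if unpickle n is Some i then
  if `[< Q i `<=` dist_gap dX dY e >] then Q i else set0 else set0.
exists H; split.
  move=> n; rewrite /H; case: unpickle => [i|]; last exact: box_set0.
  by case: ifP => _ //; exact: box_set0.
apply/seteqP; split; last first.
  move=> p [n _]; rewrite /H; case: unpickle => [i|//].
  by case: ifPn => // /asboolP; exact.
move=> [[x1 y1] [x2 y2]]; rewrite /dist_gap/= => xye.
set g := `|_| in xye.
(* Moving within the balls changes each of the two distances by less than 4 radii, hence the gap by
   less than 8. *)
have [k _ /(_ k (leqnn _)) hk] :
    \forall k \near \oo, k.+1%:R^-1 < (g - e) / 8.
  have ge0 : 0 < (g - e) / 8 by rewrite divr_gt0// subr_gt0.
  exact: (near_infty_natSinv_lt (PosNum ge0)).
have k0 : 0 < k.+1%:R^-1 :> R by rewrite invr_gt0.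
have [a1 ha1] := hu x1 _ k0; have [a2 ha2] := hu x2 _ k0.
have [b1 hb1] := hv y1 _ k0; have [b2 hb2] := hv y2 _ k0.
exists (pickle ((a1, b1, a2, b2, k) : J)); first exact: I.
rewrite /H pickleK ifT//; apply/asboolP.
move=> [[x1' y1'] [x2' y2']] /= [[x1a y1b] [x2a y2b]]; rewrite /dist_gap/=.
have := dist_le_near hX ha1 ha2 x1a x2a.
have := dist_le_near hY hb1 hb2 y1b y2b.
have : g <= `|dX x1' x2' - dY y1' y2'| + `|dX x1 x2 - dX x1' x2'| +
    `|dY y1 y2 - dY y1' y2'|.
  rewrite /g (_ : dX x1 x2 - dY y1 y2 = (dX x1' x2' - dY y1' y2') +
    (dX x1 x2 - dX x1' x2') - (dY y1 y2 - dY y1' y2')); last by lra.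
  by apply: le_trans (ler_normB _ _) _; rewrite lerD2r ler_normD.
move: hk xye; clear; set k' := (_^-1); lra.
Qed.

Lemma dist_gap_measurable e : measurable (dist_gap dX dY e).
Proof.
have [H [bH ->]] := dist_gap_bigcup_box e.
by apply: bigcupT_measurable => n; exact: box_measurable.
Qed.

Lemma subset_dist_gap e e' : e <= e' -> dist_gap dX dY e' `<=` dist_gap dX dY e.
Proof. by move=> ee p; exact: le_lt_trans. Qed.

Lemma le_dist_gap (P : probability T R) e e' : e <= e' ->
  ((P \x P) (dist_gap dX dY e') <= (P \x P) (dist_gap dX dY e))%E.
Proof.
move=> ee; apply: le_measure; rewrite ?inE; try exact: dist_gap_measurable.
exact: subset_dist_gap.
Qed.

(** Right-continuity of the tail: the set for [v] is the increasing union of those for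
    [v + r / (n+1)], each of mass at most [v + r]. *)
Lemma dist_gap_le_right (P : probability T R) (v : R) :
  (forall e, v < e -> ((P \x P) (dist_gap dX dY e) <= e%:E)%E) ->
  ((P \x P) (dist_gap dX dY v) <= v%:E)%E.
Proof.
move=> h; apply/lee_addgt0Pr => r r0; rewrite -EFinD.
have -> : dist_gap dX dY v = \bigcup_n dist_gap dX dY (v + r / n.+1%:R).
  apply/seteqP; split=> p; last first.
    move=> [n _]; apply: subset_dist_gap.
    by rewrite lerDl divr_ge0// ltW.
  rewrite /dist_gap/=; set g := `|_| => vg.
  have gv : 0 < (g - v) / r by rewrite divr_gt0// subr_gt0.
  have [n _ /(_ n (leqnn _)) /= hn] := near_infty_natSinv_lt (PosNum gv).
  by exists n => //=; move: hn; rewrite ltr_pdivlMr// mulrC ltrBrDl.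
apply: (@probability_bigcup_le _ _ _ (P \x P)%E).
- by move=> n; exact: dist_gap_measurable.
- move=> m n mn; apply: subset_dist_gap; rewrite lerD2l ler_pM2l//.
  by rewrite lef_pV2 ?posrE// ler_nat.
- move=> n; apply: le_trans (h _ _) _; first by rewrite ltrDl divr_gt0.
  rewrite lee_fin lerD2l ler_pdivrMr//.
  by apply: ler_peMr; [exact: ltW | rewrite ler1n].
Qed.

Lemma eur_inner_le_obj (P : probability T R) e : 0 <= e ->
  (eur_inner dX dY P <= eur_obj dX dY P e)%E.
Proof. by move=> e0; apply: ereal_inf_lbound; exists e. Qed.

Lemma eur_inner_ge0 (P : probability T R) : (0 <= eur_inner dX dY P)%E.
Proof.
apply: le_ereal_inf_tmp => _ [e e0 <-].
by rewrite le_max lee_fin e0.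
Qed.

Lemma eur_inner_le1 (P : probability T R) : (eur_inner dX dY P <= 1)%E.
Proof.
apply: le_trans (eur_inner_le_obj P ler01) _.
rewrite ge_max lexx; apply: (@probability_le1 _ _ _ (P \x P)%E).
exact: dist_gap_measurable.
Qed.

(** Some [r < e] has tail below [e], and the tail is nonincreasing. *)
Lemma eur_inner_lt_gap (P : probability T R) e : (eur_inner dX dY P < e%:E)%E ->
  ((P \x P) (dist_gap dX dY e) <= e%:E)%E.
Proof.
move=> /ereal_inf_ltP[_ [r r0 <-]]; rewrite gt_max lte_fin => /andP[re gr].
by apply: le_trans (ltW gr); apply: le_dist_gap; exact: ltW.
Qed.

(** Attainment criterion, used both for a fixed coupling and for the limit coupling:
    right-continuity bounds the tail at [v] by [v]. *)
Lemma eur_obj_eq (P : probability T R) (v : R) :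
  (forall e, v < e -> ((P \x P) (dist_gap dX dY e) <= e%:E)%E) ->
  eur_obj dX dY P v = v%:E.
Proof. by move=> /dist_gap_le_right ?; apply/max_idPl. Qed.

(** This replaces semicontinuity on open sets under weak convergence: the measures converge on
    finite unions of boxes, and these increase to the gap set. *)
Lemma ultralimit_dist_gap_le (W : set_system nat) (uW : UltraFilter W)
    (P_ : nat -> probability T R) (P : probability T R) (e c : R) :
  (forall A B, measurable A -> measurable B ->
    fine (P_ n (A `*` B)) @[n --> W] --> fine (P (A `*` B))) ->
  W [set n | ((P_ n \x P_ n) (dist_gap dX dY e) <= c%:E)%E] ->
  ((P \x P) (dist_gap dX dY e) <= c%:E)%E.
Proof.
move=> cP Wc; have pW : ProperFilter W by exact: ultra_proper.
have [H [bH gapE]] := dist_gap_bigcup_box e.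
have mH n : measurable (H n) by exact: box_measurable.
have mU N : measurable (\big[setU/set0]_(i < N) H i).
  exact: bigsetU_measurable.
have cbox S : box S -> fine ((P_ n \x P_ n)%E S) @[n --> W] --> fine ((P \x P)%E S).
  move=> [A1 [B1 [A2 [B2 [mA1 mB1 mA2 mB2 ->]]]]].
  have QE (Q : probability T R) : fine ((Q \x Q)%E ((A1 `*` B1) `*` (A2 `*` B2))) =
      fine (Q (A1 `*` B1)) * fine (Q (A2 `*` B2)).
    rewrite product_measure1E ?fineM ?fin_num_measure//; exact: measurableX.
  under eq_fun do rewrite QE.
  by rewrite QE; apply: cvgM; exact: cP.
rewrite gapE -bigcup_bigsetU_bigcup.
apply: (@probability_bigcup_le _ _ _ (P \x P)%E) => //.
  by move=> m n mn; exact: subset_bigsetU.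
move=> N; rewrite -[leLHS]fineK ?fin_num_measure// lee_fin.
have cN := @cvg_probability_bigsetU _ _ _ _ uW (fun n => (P_ n \x P_ n)%E)
  (P \x P)%E _ box_setI box_measurable cbox H N.+1 bH.
apply: (@cvgr_to_le _ W pW R _ _ c cN).
apply: filterS Wc => n gc; rewrite -lee_fin fineK; last first.
  by apply: fin_num_measure; exact: mU.
apply: le_trans gc; apply: le_measure; rewrite ?inE.
- exact: mU.
- exact: (dist_gap_measurable e).
by rewrite gapE -(bigcup_mkord N.+1 H) => p [i _ Hp]; exists i.
Qed.

End gap.

(** * Attainment of the two minima *)

Theorem theorem6p3 (R : realType) (d1 d2 : measure_display)
  (T1 : measurableType d1) (T2 : measurableType d2)
  (dX : T1 -> T1 -> R) (dY : T2 -> T2 -> R)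
  (mX : probability T1 R) (mY : probability T2 R)
  (hX : mm_space dX) (hY : mm_space dY) :
  (forall pi : probability (T1 * T2)%type R, coupling mX mY pi ->
     exists eps : R, 0 <= eps /\ eur_obj dX dY pi eps = eur_inner dX dY pi) /\
  (exists pi : probability (T1 * T2)%type R,
     coupling mX mY pi /\ eur_inner dX dY pi = d_Eur dX dY mX mY).
Proof.
split=> [pi _|].
  have i0 := eur_inner_ge0 dX dY pi; have i1 := eur_inner_le1 hX hY pi.
  have ifin : eur_inner dX dY pi \is a fin_num.
    by rewrite ge0_fin_numE// (le_lt_trans i1) ?ltry.
  (* The infimum itself serves as the minimizing [eps]. *)
  exists (fine (eur_inner dX dY pi)); split; first exact: fine_ge0.
  rewrite -[RHS]fineK//; apply: eur_obj_eq => // e ve.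
  by apply: eur_inner_lt_gap => //; rewrite -(fineK ifin) lte_fin.
set v := d_Eur dX dY mX mY.
have v0 : (0 <= v)%E.
  by apply: le_ereal_inf_tmp => _ [pi _ <-]; exact: eur_inner_ge0.
have v1 : (v <= 1)%E.
  (* The product measure is a coupling, so [v] is not an infimum over the empty set. *)
  have [pi cpi] : exists pi, coupling mX mY pi.
    exists (mX \x mY)%E; split=> A mA.
      rewrite -setXT; apply: (etrans (product_measure1E _ _ mA measurableT)).
      by rewrite [X in (_ * X)%E]probability_setT mule1.
    rewrite -setTX; apply: (etrans (product_measure1E _ _ measurableT mA)).
    by rewrite [X in (X * _)%E]probability_setT mul1e.
  apply: le_trans (eur_inner_le1 hX hY pi).
  by apply: ereal_inf_lbound; exists pi.
have vfin : v \is a fin_num by rewrite ge0_fin_numE// (le_lt_trans v1) ?ltry.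
have /choice[P_ hP] n : exists pi : probability (T1 * T2)%type R,
    coupling mX mY pi /\ (eur_inner dX dY pi < v + (n.+1%:R^-1)%:E)%E.
  have n0 : 0 < n.+1%:R^-1 :> R by rewrite invr_gt0.
  have [_ [pi cpi <-] h] := lb_ereal_inf_adherent n0 vfin.
  by exists pi.
have [W [uW oW]] := ultraFilterLemma eventually_filter.
have [lam hlam] := ultralimit_content uW P_.
have pW : ProperFilter W by exact: ultra_proper.
(* Both marginals of [P_ n] are constant in [n], so the limit content has them too. *)
have lamE A (a : \bar R) : measurable A -> (forall n, P_ n A = a) -> lam A = a.
  move=> mA Pa; have [lfin cl] := hlam A mA.
  have fa : a \is a fin_num by rewrite -(Pa 0%N) fin_num_measure.
  apply/eqP; rewrite -(fineK lfin) -(fineK fa); apply/eqP; congr EFin.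
  rewrite -(cvg_lim (@Rhausdorff R) cl); under eq_fun do rewrite Pa.
  by rewrite lim_cst//; exact: Rhausdorff.
have [pi [cpi piE]] : exists pi : probability (T1 * T2)%type R,
    coupling mX mY pi /\ forall A B, measurable A -> measurable B ->
      pi (A `*` B) = lam (A `*` B).
  apply: (coupling_of_content hX hY) => A mA; apply: lamE => [|n].
  - by rewrite -[X in measurable X]setTI; exact: measurable_fst.
  - by have [[-> //]] := hP n.
  - by rewrite -[X in measurable X]setTI; exact: measurable_snd.
  - by have [[_ -> //]] := hP n.
exists pi; split => //.
have gap_pi e : fine v < e -> ((pi \x pi) (dist_gap dX dY e) <= e%:E)%E.
  move=> ve; apply: (ultralimit_dist_gap_le hX hY uW (P_ := P_)).
    move=> A B mA mB; rewrite piE//.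
    by have [] := hlam (A `*` B) (measurableX mA mB).
  have ev0 : 0 < e - fine v by rewrite subr_gt0.
  (* For large [n] the inner infimum of [P_ n] is below [v + 1/(n+1) < e], so its tail at [e] is at
     most [e]. *)
  apply: filterS (oW _ (near_infty_natSinv_lt (PosNum ev0))) => n /= hn.
  apply: eur_inner_lt_gap => //; apply: lt_le_trans (hP n).2 _.
  by rewrite -(fineK vfin) -EFinD lee_fin -lerBrDl ltW.
apply/eqP; rewrite eq_le; apply/andP; split.
  (* The objective of [pi] at [eps = v] equals [v], which bounds its inner infimum from above. *)
  apply: le_trans (eur_inner_le_obj _ _ _ (fine_ge0 v0)) _.
  by rewrite (eur_obj_eq hX hY gap_pi) fineK.
by apply: ereal_inf_lbound; exists pi.
Qed.
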